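(* Let $f\colon\mathbb{R}^2\to\mathbb{R}^2$ be a $C^1$ semi-algebraic map with nowhere zero Jacobian determinant, and let $S_f\subset\mathbb{R}^2$ be the set of points at which $f$ is not proper. If $\operatorname{codim}(S_f)\geq 2$, then $f$ is bijective.
   Context: A continuous map $f\colon X\to Y$ between locally compact spaces is proper at $y\in Y$ if there is a neighborhood $U$ of $y$ such that $f^{-1}(\overline{U})$ is compact; $S_f$ denotes the set of points of $Y$ where $f$ is not proper. For semi-algebraic $f$ the set $S_f$ is semi-algebraic, so its dimension and codimension in $\mathbb{R}^2$ make sense ($S_f=\varnothing$ is allowed and counts as satisfying the codimension hypothesis). *)

(* Defs.v *)
From HB Require Import structures.
From mathcomp Require Import all_boot all_order all_algebra.
From mathcomp Require Import all_classical all_reals all_analysis.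
From mathcomp Require mpoly.
(* The notations of [mpoly] clash with those of [all_analysis]. *)
Import (canonicals) mpoly.
Set Implicit Arguments.
Unset Strict Implicit.
Unset Printing Implicit Defensive.
Import Order.TTheory GRing.Theory Num.Theory.
Import numFieldNormedType.Exports.

Local Open Scope classical_set_scope.
Local Open Scope ring_scope.

Definition mpeval (R : realType) (n : nat) (p : mpoly.mpoly n R)
    (x : 'rV[R]_n) : R :=
  mpoly.meval (fun i => x ord0 i) p.

(* The Boolean algebra of subsets of R^n generated by the sets {p > 0}; the
   set {p = 0} is the complement of {p > 0} `|` {- p > 0}. *)
Inductive semialgebraic (R : realType) (n : nat) : set 'rV[R]_n -> Prop :=
| semialgebraic_pos (p : mpoly.mpoly n R) :
    semialgebraic [set x | 0 < mpeval p x]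
| semialgebraic_setC (A : set 'rV[R]_n) :
    semialgebraic A -> semialgebraic (~` A)
| semialgebraic_setU (A B : set 'rV[R]_n) :
    semialgebraic A -> semialgebraic B -> semialgebraic (A `|` B).

Definition semialgebraic_map (R : realType) (n m : nat)
    (f : 'rV[R]_n -> 'rV[R]_m) : Prop :=
  semialgebraic [set z : 'rV[R]_(n + m) | f (lsubmx z) = rsubmx z].

Definition vanishing_ideal (R : realType) (n : nat) (A : set 'rV[R]_n) :
    set (mpoly.mpoly n R) :=
  [set p | forall x, A x -> mpeval p x = 0].

(* A strict chain P 0 < ... < P d of prime ideals of R[X_1, ..., X_n] containing
   I(A), i.e. of prime ideals of the quotient R[X_1, ..., X_n] / I(A);
   [idealr_closed] includes properness. *)
Definition prime_chain (R : realType) (n : nat) (A : set 'rV[R]_n) (d : nat)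
    (P : nat -> {pred mpoly.mpoly n R}) : Prop :=
  [/\ forall i, (i <= d)%N -> idealr_closed (P i) /\ prime_idealr_closed (P i),
      forall p, vanishing_ideal A p -> p \in P 0%N &
      forall i, (i < d)%N ->
        {subset P i <= P i.+1} /\ ~ {subset P i.+1 <= P i}].

(* The dimension of a semi-algebraic set A is the Krull dimension of the ring
   R[X_1, ..., X_n] / I(A) of polynomial functions on A (Bochnak, Coste, Roy,
   Real Algebraic Geometry, 2.8.1). The empty set has dimension -oo, hence
   codimension +oo. *)
Definition semialg_dim (R : realType) (n : nat) (A : set 'rV[R]_n) : \bar R :=
  ereal_sup [set (d%:R)%:E | d in [set d : nat | exists P, prime_chain A d P]].

Definition semialg_codim (R : realType) (n : nat) (A : set 'rV[R]_n) : \bar R :=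
  ((n%:R)%:E - semialg_dim A)%E.

Definition proper_at (X Y : topologicalType) (f : X -> Y) (y : Y) : Prop :=
  exists U : set Y, nbhs y U /\ compact (f @^-1` closure U).

Definition nonproper_set (X Y : topologicalType) (f : X -> Y) : set Y :=
  [set y | ~ proper_at f y].

Definition C1_map (R : realType) (n m : nat) (f : 'rV[R]_n -> 'rV[R]_m) : Prop :=
  (forall x, differentiable f x) /\ continuous (jacobian f).

(* Main.v *)
Require Import Defs.
From HB Require Import structures.
From mathcomp Require Import all_boot all_order all_algebra.
From mathcomp Require Import all_classical all_reals all_analysis.
From mathcomp Require Import finmap.
From mathcomp Require mpoly.
From mathcomp Require Import ring lra.
Import (canonicals, coercions) mpoly.
Import Order.TTheory GRing.Theory Num.Theory.
Import numFieldNormedType.Exports.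
Local Open Scope classical_set_scope.
Local Open Scope ring_scope.

(** The non-properness set S of [f] has Krull dimension at most 0, which forces
    it to be finite ([finite_of_semialg_codim]): on an infinite set some
    coordinate takes infinitely many values, and then the polynomials vanishing
    on the set lie under two nested primes ([prime_chain1]).

    Finiteness of S makes [f] proper. The range of [f] is open, and closed away
    from S, so a line that starts in the range and avoids S stays in the range;
    hence [f] is unbounded ([unbounded_of_finite_nonproper]). Take M such that
    S lies in the open ball of radius M. The sphere of radius M is compact and
    avoids S, so its preimage lies in a ball of some radius D. The exterior of
    that ball is connected, as the plane has a single end, and |f| avoids the
    value M on it; since [f] is unbounded, |f| > M throughout the exterior. So
    the preimage of the ball of radius M is bounded, and no point of it can
    belong to S ([proper_of_bounded_nonproper]).

    By the inverse function theorem ([C1_local_homeo]) [f] is now a proper local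
    homeomorphism. It is onto because its range is closed and open. It is
    injective because the target can be contracted onto any of its points y0
    along straight segments: lifting the contraction of the image of a segment
    that joins two points of the fibre over y0 yields a continuous map from that
    segment to the fibre which fixes both ends, and the fibre is discrete
    ([proper_local_homeo_injective]). *)

(** * Infinite sets have positive Krull dimension *)

(** Properness is left out, so that the ideals generated below qualify before
    they are known to be proper. *)
Definition ideal_set (A : comNzRingType) (I : set A) : Prop :=
  I 0 /\ forall a u v, I u -> I v -> I (a * u + v).

(** Krull's separation lemma: an ideal that is maximal among those containing [I]
    and avoiding [S] is prime. If neither [u] nor [v] lies in it, adjoining
    either of them meets [S], and the product of the two elements of [S]
    obtained in this way is congruent to a multiple of [u * v]. *)
Lemma prime_ideal_avoiding (A : comNzRingType) (I S : set A) :
  ideal_set A I -> S 1 -> (forall u v, S u -> S v -> S (u * v)) ->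
  (forall u, I u -> ~ S u) ->
  exists P : {pred A}, [/\ idealr_closed P, prime_idealr_closed P,
    forall u, I u -> u \in P & forall u, u \in P -> ~ S u].
Proof.
move=> [I0 Iid] S1 SM IS.
(* [set0] is admitted because it is the union of the empty chain. *)
pose good := [set J : set A | (J = set0 \/ (ideal_set A J /\ I `<=` J)) /\
  forall u, J u -> ~ S u].
have [|J [[Jor JS] Jmax]] := @Zorn_bigcup A good.
  move=> F Fgood Ftot; split; last first.
    by move=> u [X FX Xu]; have [_] := Fgood _ FX; exact.
  have [[X [FX Xn0]]|Fempty] := pselect (exists X, F X /\ X <> set0); last first.
    left; rewrite -subset0 => u [X FX Xu]; apply: Fempty; exists X; split => //.
    by move=> X0; rewrite X0 in Xu.
  have Fid Y u : F Y -> Y u -> ideal_set A Y /\ I `<=` Y.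
    by move=> FY Yu; have [[Y0|//] _] := Fgood _ FY; rewrite Y0 in Yu.
  have [u Xu] : X !=set0 by apply/set0P/eqP.
  have [Xid IX] := Fid _ _ FX Xu.
  right; split; last by move=> v /IX; exists X.
  split; first by exists X => //; exact: Xid.1.
  move=> a v w [Y FY Yv] [Z FZ Zw].
  have [[_ Yid] _] := Fid _ _ FY Yv; have [[_ Zid] _] := Fid _ _ FZ Zw.
  have [YZ|ZY] := Ftot _ _ FY FZ.
  - by exists Z => //; apply: Zid => //; exact: YZ.
  - by exists Y => //; apply: Yid => //; exact: ZY.
have [Jid IJ] : ideal_set A J /\ I `<=` J.
  case: Jor => // J0; exfalso; apply: (Jmax I).
    by rewrite J0; split; [exact: sub0set|move/(_ 0 I0)].
  by split => //; right; split.
have [J0 JD] := Jid.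
have extend x : ~ J x -> exists2 j, J j & exists r, S (j + r * x).
  move=> Jx; apply: contrapT => noS.
  apply: (Jmax [set y | exists2 j, J j & exists r, y = j + r * x]).
    split; first by move=> j Jj; exists j => //; exists 0; rewrite mul0r addr0.
    by move=> /(_ x) xJ; apply: Jx; apply: xJ; exists 0 => //; exists 1; rewrite mul1r add0r.
  split; last by move=> y [j Jj [r ->]] Sy; apply: noS; exists j => //; exists r.
  right; split; last by move=> y /IJ Jy; exists y => //; exists 0; rewrite mul0r addr0.
  split; first by exists 0 => //; exists 0; rewrite mul0r addr0.
  move=> a u v [j Jj [r ->]] [k Jk [s ->]].
  exists (a * j + k); first exact: JD.
  by exists (a * r + s); ring.
exists (fun u => `[< J u >]); split.
- split; first exact/asboolP.
    by apply/negP => /asboolP /JS; exact.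
  by move=> a u v /asboolP Ju /asboolP Jv; apply/asboolP; exact: JD.
- move=> u v /asboolP Juv; apply/orP; apply: contrapT => uv.
  have [j Jj [r Sr]] : exists2 j, J j & exists r, S (j + r * u).
    by apply: extend => Ju; apply: uv; left; apply/asboolP.
  have [k Jk [s Ss]] : exists2 j, J j & exists r, S (j + r * v).
    by apply: extend => Jv; apply: uv; right; apply/asboolP.
  have := SM _ _ Sr Ss.
  have -> : (j + r * u) * (k + s * v) =
     (k + s * v) * j + ((r * u) * k + ((r * s) * (u * v) + 0)) by ring.
  by apply: JS; apply: (JD) => //; apply: (JD) => //; apply: (JD).
- by move=> u /IJ Ju; apply/asboolP.
- by move=> u /asboolP /JS.
Qed.

(** Polynomials of bounded degree form a finite-dimensional space. *)
Lemma mpoly_lin_dep (R : fieldType) (n d N : nat) (h : 'I_N -> mpoly.mpoly n R) :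
  (#|{: mpoly.bmultinom n d}| < N)%N ->
  (forall k, (mpoly.msize (h k) <= d)%N) ->
  exists2 l : 'I_N -> R, exists k, l k != 0 & \sum_k l k *: h k = 0.
Proof.
move=> dN hd.
pose H : 'M[R]_(N, #|{: mpoly.bmultinom n d}|) :=
  \matrix_(k, j) mpoly.mcoeff (mpoly.bmnm (enum_val j)) (h k).
have : kermx H != 0.
  rewrite -mxrank_eq0 mxrank_ker subn_eq0 -ltnNge.
  by apply: leq_ltn_trans dN; exact: rank_leq_col.
case/matrix0Pn => i [j lij].
exists (fun k => kermx H i k); first by exists j.
apply/mpoly.mpolyP => m; rewrite mpoly.mcoeff0 raddf_sum /=.
under eq_bigr do rewrite mpoly.mcoeffZ.
have [md|md] := ltnP (mpoly.mdeg m) d; last first.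
  rewrite big1 // => k _; rewrite (mpoly.memN_msupp_eq0 _) ?mulr0 //.
  by apply: mpoly.msize_mdeg_ge; exact: leq_trans (hd k) md.
have /matrixP/(_ i (enum_rank (mpoly.BMultinom md))) := mulmx_ker H.
rewrite [RHS]mxE [LHS]mxE => Hl; rewrite -[RHS]Hl; apply: eq_bigr => k _ /=.
by rewrite [H k _]mxE enum_rankK.
Qed.

Section dimension.
Context {R : realType} {n : nat}.
Implicit Types (A : set 'rV[R]_n) (i : 'I_n).

(** The nonzero polynomials in the variable of index [i] alone. Evaluation
    identifies them, as a polynomial over an infinite field is determined by its
    values. *)
Definition univariate_in i : set (mpoly.mpoly n R) :=
  [set p | exists2 q : {poly R}, q != 0 & forall x, mpeval p x = q.[x ord0 i]].

Lemma real_not_countable : ~ countable [set: R].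
Proof.
move=> cR; have /countable_lebesgue_measure0 : countable (`[0, 1]%classic : set R).
  by apply: sub_countable cR; exact: subset_card_le.
rewrite lebesgue_measure_itv /= lte_fin ltr01 => /eqP.
by rewrite -EFinB eqe subr0 oner_eq0.
Qed.

Local Notation xsub i c := (mpoly.mpolyX R (mpoly.mnm1 i) - mpoly.mpolyC n c).

Lemma mpeval_xsub i c x : mpeval (xsub i c) x = x ord0 i - c.
Proof. by rewrite /mpeval mpoly.mevalB mpoly.mevalXU mpoly.mevalC. Qed.

Lemma univariate_in1 i : univariate_in i 1.
Proof.
exists 1; first exact: oner_neq0.
by move=> x; rewrite /mpeval mpoly.meval1 hornerC.
Qed.

Lemma univariate_inM i p q :
  univariate_in i p -> univariate_in i q -> univariate_in i (p * q).
Proof.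
move=> [u u0 pu] [v v0 qv]; exists (u * v); first by rewrite mulf_neq0.
by move=> x; rewrite hornerM -pu -qv /mpeval mpoly.mevalM.
Qed.

Lemma univariate_in_xsub i c : univariate_in i (xsub i c).
Proof.
by exists ('X - c%:P); [rewrite polyXsubC_eq0|move=> x; rewrite mpeval_xsub !hornerE].
Qed.

(** Modulo [P] the variable x of index [i] is transcendental over R, and then the
    quotient ring is too small to contain all the inverses of the x - c. If every
    x - c had an inverse h_c, infinitely many of the h_c would have bounded
    degree, because R is uncountable. These would be linearly dependent, whereas
    the fractions 1 / (x - c) are linearly independent: clearing denominators in
    a relation between them gives a nonzero polynomial in x lying in [P]. *)
Lemma nonunit_xsub i (P : {pred mpoly.mpoly n R}) :
  idealr_closed P -> prime_idealr_closed P ->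
  (forall p, p \in P -> ~ univariate_in i p) ->
  exists c, forall h, xsub i c * h - 1 \notin P.
Proof.
move=> Pid Pprime Puni; apply: contrapT => noc.
have /choice[h hP] : forall c, exists h, xsub i c * h - 1 \in P.
  move=> c; apply: contrapT => nh; apply: noc; exists c => h.
  by apply/negP => hP; apply: nh; exists h.
have [d dinf] : exists d, infinite_set [set c | (mpoly.msize (h c) <= d)%N].
  apply: contrapT => nd; apply: real_not_countable.
  have -> : [set: R] = \bigcup_d [set c | (mpoly.msize (h c) <= d)%N].
    by apply/esym/seteqP; split => // c _; exists (mpoly.msize (h c)) => /=.
  apply: bigcup_countable => // d _; apply: finite_set_countable.
  by apply: contrapT => infd; apply: nd; exists d.
have [C Cd CN] := infinite_set_fset #|{: mpoly.bmultinom n d}|.+1 dinf.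
pose N := size (enum_fset C).
pose e (k : 'I_N) : R := nth 0 (enum_fset C) k.
have einj : injective e.
  move=> j k /eqP; rewrite /e nth_uniq ?fset_uniq//.
  by move=> /eqP; exact: val_inj.
have [||l [k0 lk0] lh] := @mpoly_lin_dep R n d N (h \o e).
- exact: CN.
- by move=> k /=; apply: Cd; apply/mem_nth.
(* The relation between the inverses, multiplied by all the x - e j. *)
pose p := \sum_k l k *: \prod_(j < N | j != k) xsub i (e j).
have pP : p \in P.
  have [P0 _ PD] := Pid.
  have PM a u : u \in P -> a * u \in P by move=> uP; rewrite -[a * u]addr0 PD.
  have Psum (F : 'I_N -> mpoly.mpoly n R) :
      (forall k, F k \in P) -> \sum_k F k \in P.
    move=> FP; elim/big_ind : _ => // u v uP vP.
    by rewrite -[u]mul1r PD.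
  have -> : p = \sum_k - (l k *: \prod_(j < N | j != k) xsub i (e j)) *
                 (xsub i (e k) * h (e k) - 1).
    transitivity (p - \prod_(j < N) xsub i (e j) * \sum_k l k *: h (e k)).
      by rewrite lh mulr0 subr0.
    rewrite mulr_sumr -sumrB; apply: eq_bigr => k _.
    rewrite [X in _ - X * _](bigD1 k)//= mulNr mulrBr mulr1 opprB.
    congr (_ - _).
    rewrite -!scalerAl -scalerAr; congr (_ *: _).
    by rewrite mulrA; congr (_ * _); rewrite mulrC.
  by apply: Psum => k; exact: PM.
apply: (Puni p pP).
exists (\sum_k l k *: \prod_(j < N | j != k) ('X - (e j)%:P)).
  (* At [e k0] only the term of index [k0] survives. *)
  apply/eqP => /(congr1 (fun q => q.[e k0])).
  rewrite horner0 horner_sum (bigD1 k0)//= [X in _ + X]big1 ?addr0.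
    rewrite hornerZ horner_prod => /eqP; rewrite mulf_eq0 (negbTE lk0)/=.
    apply/negP; rewrite prodf_seq_neq0; apply/allP => j _; apply/implyP => jk.
    by rewrite !hornerE subr_eq0; apply: contraNneq jk => /einj ->.
  move=> k kk0; rewrite hornerZ horner_prod (bigD1 k0) 1?eq_sym//=.
  by rewrite hornerXsubC subrr mul0r mulr0.
move=> x; rewrite /mpeval /p.
rewrite (raddf_sum (mpoly.meval (fun i => x ord0 i))) horner_sum.
apply: eq_bigr => k _ /=; rewrite mpoly.mevalZ hornerZ; congr (_ * _).
rewrite horner_prod (rmorph_prod (mpoly.meval (fun i => x ord0 i))).
by apply: eq_bigr => j _; rewrite hornerXsubC; exact: mpeval_xsub.
Qed.

Lemma vanishing_ideal_closed A : ideal_set (mpoly.mpoly n R) (vanishing_ideal A).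
Proof.
split; first by move=> x _; rewrite /mpeval mpoly.meval0.
move=> a u v Iu Iv x Ax; rewrite /mpeval mpoly.mevalD mpoly.mevalM.
by rewrite -!/(mpeval _ x) (Iu x)// (Iv x)// mulr0 addr0.
Qed.

(** The polynomials vanishing on [A] avoid the nonzero polynomials in x_i alone,
    as these have finitely many roots. A prime P above them that still avoids
    these polynomials is not maximal: some x_i - c is neither in P nor invertible
    modulo P, so a larger prime contains it. *)
Lemma prime_chain1 A i : infinite_set [set x ord0 i | x in A] ->
  exists P, prime_chain A 1 P.
Proof.
move=> Ainf.
have [|P [Pid Pprime IP PS]] := @prime_ideal_avoiding _ (vanishing_ideal A)
  (univariate_in i) (vanishing_ideal_closed A) (univariate_in1 i)
  (@univariate_inM i).
  move=> p Ip [q q0 pq].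
  have [C CA] := infinite_set_fset (size q) Ainf.
  apply/negP; rewrite -ltnNge; apply: max_poly_roots => //; last exact: fset_uniq.
  by apply/allP => _ /CA[x Ax <-]; rewrite /root -pq (Ip x Ax).
have [c cP] := nonunit_xsub _ _ Pid Pprime PS.
have [P0 P1 PD] := Pid.
have [||||Q [Qid Qprime IQ _]] := @prime_ideal_avoiding _
  [set p | exists2 u, u \in P & exists r, p = u + r * xsub i c] [set 1].
- split; first by exists 0 => //; exists 0; rewrite mul0r addr0.
  move=> a _ _ [u uP [r ->]] [v vP [s ->]].
  by exists (a * u + v); [exact: PD|exists (a * r + s); ring].
- by [].
- by move=> _ _ -> ->; rewrite mulr1.
- move=> _ [u uP [r ->]] u1; apply/negP: (cP r); apply/negPn.
  have -> : xsub i c * r - 1 = -1 * u + 0.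
    have -> : u = 1 - r * xsub i c by rewrite -u1 addrK.
    by ring.
  exact: PD.
exists (fun k => if k is 0%N then P else Q); split.
- by case=> [|[|]].
- exact: IP.
- move=> [|//] _; split.
    by move=> u uP; apply: IQ; exists u => //; exists 0; rewrite mul0r addr0.
  move=> QP; apply: (PS (xsub i c)); last exact: univariate_in_xsub.
  by apply: QP; apply: IQ; exists 0 => //; exists 1; rewrite mul1r add0r.
Qed.

Lemma finite_of_semialg_dim0 A : (semialg_dim A <= 0)%E -> finite_set A.
Proof.
move=> A0.
have fin i : finite_set [set x ord0 i | x in A].
  apply: contrapT => /prime_chain1[P AP].
  suff : (1%:R%:E <= semialg_dim A)%E by move=> /le_trans/(_ A0); rewrite lee_fin ler10.
  by apply: ereal_sup_ubound; exists 1%N => //; exists P.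
have [F FA] : exists F : 'I_n -> {fset R}, forall x, A x -> forall i, x ord0 i \in F i.
  exists (fun i => fset_set [set x ord0 i | x in A]) => x Ax i.
  by rewrite in_fset_set //; apply/mem_set; exists x.
apply: (@sub_finite_set _ _ ((fun g : {dffun forall i, F i} => \row_i val (g i)) @` setT));
    last by apply: finite_image; exact: finite_finset.
move=> x Ax; exists [ffun i => [` FA x Ax i]%fset] => //.
by apply/rowP => i; rewrite mxE ffunE.
Qed.

Lemma finite_of_semialg_codim A : (n%:R%:E <= semialg_codim A)%E -> finite_set A.
Proof.
move=> nA; apply: finite_of_semialg_dim0.
move: nA; rewrite /semialg_codim; case: (semialg_dim A) => [d||] //=.
by rewrite -EFinB !lee_fin lerBrDr gerDl.
Qed.

End dimension.

(** * The inverse function theorem *)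

Section row_norm.
Context {R : realType}.

Lemma row_norm_ge m n (x : 'M[R]_(m, n)) i j : `|x i j| <= `|x|.
Proof.
rewrite [leRHS]/Num.norm /= mx_normrE; apply/bigmax_geP; right.
by exists (i, j).
Qed.

Lemma row_norm_le m n (x : 'M[R]_(m, n)) (c : R) : 0 <= c ->
  (forall i j, `|x i j| <= c) -> `|x| <= c.
Proof.
move=> c0 xc; rewrite [leLHS]/Num.norm /= mx_normrE; apply/bigmax_leP.
by split=> // -[i j] _; exact: xc.
Qed.

Lemma norm_mulmx m n (x : 'rV[R]_m) (A : 'M[R]_(m, n)) :
  `|x *m A| <= m%:R * `|A| * `|x|.
Proof.
apply: row_norm_le => [|i j]; first by rewrite !mulr_ge0.
rewrite mxE; apply: le_trans (ler_norm_sum _ _ _) _.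
apply: (@le_trans _ _ (\sum_(k < m) `|A| * `|x|)).
  by apply: ler_sum => k _; rewrite normrM mulrC ler_pM ?row_norm_ge.
by rewrite sumr_const card_ord -[leLHS]mulr_natl mulrA.
Qed.

End row_norm.

Lemma continuous_dist (R : realType) (V : normedModType R) (T : topologicalType)
    (f : T -> V) y x : {for x, continuous f} ->
  {for x, continuous (fun u => `|f u - y|)}.
Proof.
move=> fx.
have fyx : {for x, continuous (f - cst y)} by apply: continuousB => //; exact: cst_continuous.
exact: cvg_norm fyx.
Qed.

Lemma closed_dist_le (R : realType) m n (f : 'rV[R]_m -> 'rV[R]_n) y (s : R) :
  continuous f -> closed [set x | `|f x - y| <= s].
Proof.
move=> fc.
have -> : [set x | `|f x - y| <= s] =
  (fun x => `|f x - y|) @^-1` [set t : R | t <= s] by [].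
apply: closed_comp => [x _|]; last exact: closed_le.
by apply: continuous_dist; exact: fc.
Qed.

Lemma bounded_setP (R : realType) n (A : set 'rV[R]_n) (M : R) :
  (forall x, A x -> `|x| <= M) -> bounded_set A.
Proof.
move=> AM; exists M; split; first exact: num_real.
by move=> N MN x /AM xM; exact: le_trans xM (ltW MN).
Qed.

Lemma compact_dist_le (R : realType) n (y : 'rV[R]_n) (s : R) :
  compact [set x | `|x - y| <= s].
Proof.
apply: bounded_closed_compact.
  apply: (bounded_setP _ _ _ (s + `|y|)) => x /= xs.
  by rewrite -[x](subrK y); apply: le_trans (ler_normD _ _) _; rewrite lerD2r.
by apply: (closed_dist_le _ _ _ id) => x; exact: cvg_id.
Qed.

Definition locally_injective {R : realType} {n} (f : 'rV[R]_n -> 'rV[R]_n) :=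
  forall x, exists2 r : R, 0 < r &
    forall u v, ball x r u -> ball x r v -> f u = f v -> u = v.

Definition neighborhood_open {R : realType} {n} (f : 'rV[R]_n -> 'rV[R]_n) :=
  forall x A, nbhs x A -> nbhs (f x) (f @` A).

Section inverse_function.
Context {R : realType}.

Lemma is_derive_along m n (f : 'rV[R]_m -> 'rV[R]_n) (v w : 'rV[R]_m) t j :
  differentiable f (v + t *: w) ->
  is_derive t 1 (fun s : R => f (v + s *: w) ord0 j)
    ((w *m jacobian f (v + t *: w)) ord0 j).
Proof.
move=> df.
have linP : is_diff t (fun s : R => v + s *: w) (fun s => 0 + s *: w).
  exact: is_diffD.
have fP := differentiableP df.
have gP : is_diff t (f \o (fun s : R => v + s *: w))
    ('d f (v + t *: w) \o (fun s => 0 + s *: w)).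
  exact: is_diff_comp.
have gd : derivable (f \o (fun s : R => v + s *: w)) t 1.
  by apply: diff_derivable.
have gE : 'D_1 (f \o (fun s : R => v + s *: w)) t =
    w *m jacobian f (v + t *: w).
  by rewrite deriveE // diff_val /= add0r scale1r -deriveE // deriveEjacobian.
apply: DeriveDef; first by have /derivable_mxP := gd; exact.
by rewrite -gE derive_mx // mxE.
Qed.

(** The mean value theorem on the segment from [v] to [u], applied to each
    coordinate of [f] minus its linear part at [x0]: the derivative there is
    controlled by the variation of the Jacobian. *)
Lemma C1_strictly_differentiable m n (f : 'rV[R]_m -> 'rV[R]_n) x0 (e : R) :
  C1_map f -> 0 < e -> exists2 r : R, 0 < r & forall u v, ball x0 r u ->
  ball x0 r v -> `|f u - f v - (u - v) *m jacobian f x0| <= e * `|u - v|.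
Proof.
move=> [df cJ] e0.
have e'0 : 0 < e / m.+1%:R by rewrite divr_gt0.
have /cvgrPdist_le/(_ _ e'0) := cJ x0.
rewrite near_nbhs => /nbhs_ballP[r /= r0 rJ].
exists r => // u v ur vr; set w := u - v.
apply: row_norm_le => [|i j]; first by rewrite mulr_ge0 // ltW.
rewrite ord1 {i}.
pose k := (w *m jacobian f x0) ord0 j.
pose F (t : R) := f (v + t *: w) ord0 j.
pose phi : R -> R := F - k \*: (@id R).
have dphi (t : R) : is_derive t 1 phi
    ((w *m jacobian f (v + t *: w)) ord0 j - k).
  have h1 : is_derive t 1 F ((w *m jacobian f (v + t *: w)) ord0 j).
    exact: is_derive_along.
  apply: is_derive_eq; congr (_ - _); exact: mulr1.
have [|t t01] := @MVT_segment R phi _ 0 1 ler01 (fun t _ => dphi t).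
  apply: continuous_subspaceT => t; apply: differentiable_continuous.
  by apply/derivable1_diffP; apply: ex_derive.
have -> : phi 1 = f u ord0 j - k.
  by rewrite /phi /F !fctE /= scale1r /w (addrC v) subrK [k *: _]mulr1.
have -> : phi 0 = f v ord0 j.
  by rewrite /phi /F !fctE /= scale0r addr0 [k *: _]mulr0 subr0.
rewrite subr0 mulr1 => E.
have -> : (f u - f v - w *m jacobian f x0) ord0 j =
   (w *m (jacobian f (v + t *: w) - jacobian f x0)) ord0 j.
  rewrite mulmxBr.
  have key (a b p q : 'rV[R]_n) : a ord0 j - q ord0 j - b ord0 j = p ord0 j - q ord0 j ->
      (a - b - q) ord0 j = (p - q) ord0 j.
    by rewrite !mxE => <-; rewrite addrAC.
  exact: key.
apply: le_trans (row_norm_ge _ _ _ _ _) _; apply: le_trans (norm_mulmx _ _ _ _) _.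
rewrite ler_wpM2r //.
have xr : ball x0 r (v + t *: w).
  move: ur vr; rewrite -!ball_normE /= => ur vr.
  have -> : x0 - (v + t *: w) = (1 - t) *: (x0 - v) + t *: (x0 - u).
    by apply/rowP => l; rewrite !mxE; ring.
  move: t01; rewrite in_itv /= => /andP[t0 t1].
  apply: le_lt_trans (ler_normD _ _) _; rewrite !normrZ.
  rewrite ger0_norm ?subr_ge0 // ger0_norm //.
  have [->|tn0] := eqVneq t 0; first by rewrite subr0 mul1r mul0r addr0.
  have tp : 0 < t by rewrite lt_def tn0.
  have : t * `|x0 - u| < t * r by rewrite ltr_pM2l.
  have : (1 - t) * `|x0 - v| <= (1 - t) * r by rewrite ler_wpM2l ?subr_ge0 // ltW.
  by move=> h1 h2; lra.
have J : `|jacobian f (v + t *: w) - jacobian f x0| * m.+1%:R <= e.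
  by rewrite -ler_pdivlMr // distrC; exact: rJ xr.
apply: le_trans J; rewrite [leRHS]mulrC; apply: ler_wpM2r => //.
by rewrite ler_nat.
Qed.

(** [G] is the identity plus a map with Lipschitz constant 1/2. For y close to
    [G x0], a point m of a closed ball that minimises |G m - y| is interior, and
    G m = y: otherwise moving m by a small multiple of y - G m would bring G m
    closer to y. *)
Lemma near_identity_open n (G : 'rV[R]_n -> 'rV[R]_n) x0 (r : R) A :
  continuous G -> 0 < r ->
  (forall u v, ball x0 r u -> ball x0 r v ->
    `|G u - G v - (u - v)| <= 2^-1 * `|u - v|) ->
  nbhs x0 A -> nbhs (G x0) (G @` A).
Proof.
move=> cG r0 Glip /nbhs_ballP[s0 /= s00 s0A].
pose s := Num.min s0 r / 2.
have s0r : 0 < s by rewrite divr_gt0 // lt_min s00.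
have sr u : `|u - x0| <= s -> ball x0 r u.
  move=> us; rewrite -ball_normE /= distrC; apply: le_lt_trans us _.
  rewrite /s; have : Num.min s0 r <= r by rewrite ge_min lexx orbT.
  by have : 0 < Num.min s0 r := ltac:(by rewrite lt_min s00); lra.
have sA u : `|u - x0| <= s -> A u.
  move=> us; apply: s0A; rewrite -ball_normE /= distrC; apply: le_lt_trans us _.
  rewrite /s; have : Num.min s0 r <= s0 by rewrite ge_min lexx.
  by have : 0 < Num.min s0 r := ltac:(by rewrite lt_min s00); lra.
apply/nbhs_ballP; exists (s / 4) => /=; first by rewrite divr_gt0.
move=> y; rewrite -ball_normE /= => ys.
pose C := [set u | `|u - x0| <= s].
have Cc : compact C by exact: compact_dist_le.
have [|||m] := @EVT_min_rV R n (fun u => `|G u - y|) C.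
- by exists x0; rewrite /C /= subrr normr0 ltW.
- exact: Cc.
- by apply: continuous_subspaceT => u; apply: continuous_dist; exact: cG.
move=> /set_mem mC mmin; rewrite /C /= in mC.
have mx0 : `|G m - y| <= `|G x0 - y|.
  by apply: mmin; rewrite in_setE /C /= subrr normr0 ltW.
have x0r : ball x0 r x0 by exact: ballxx.
have mr := sr _ mC.
(* On the boundary |G m - G x0| >= s / 2, too far from [y] for a minimum. *)
have mlt : `|m - x0| < s.
  rewrite ltNge; apply/negP => sm.
  have h1 := Glip _ _ mr x0r.
  have h2 : `|m - x0| <= `|G m - G x0 - (m - x0)| + `|G m - G x0|.
    have := ler_normB (G m - G x0) (G m - G x0 - (m - x0)).
    by rewrite subKr [X in _ <= X]addrC.
  have h3 : `|G m - G x0| <= `|G m - y| + `|G x0 - y|.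
    by have := ler_normB (G m - y) (G x0 - y); rewrite opprB addrA subrK.
  by lra.
have [z0|zn0] := eqVneq (G m - y) 0.
  by exists m; [exact: sA|apply/eqP; rewrite -subr_eq0 z0].
exfalso; set z := G m - y in zn0 *.
have zp : 0 < `|z| by rewrite normr_gt0.
pose d := s - `|m - x0|.
have dp : 0 < d by rewrite /d; lra.
(* A step t in ]0, 1] with t |z| <= d, so that m - t z stays in the ball. *)
pose t := d / (d + `|z|).
have dzp : 0 < d + `|z| by lra.
have tp : 0 < t by rewrite divr_gt0.
have t1 : t <= 1 by rewrite ler_pdivrMr //; lra.
have tz : t * `|z| <= d by rewrite mulrAC ler_pdivrMr // ler_wpM2l ?ltW //; lra.
have m'C : `|m - t *: z - x0| <= s.
  rewrite addrAC; apply: le_trans (ler_normB _ _) _.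
  by rewrite normrZ (gtr0_norm tp); rewrite /d in tz; lra.
have := mmin (m - t *: z); rewrite in_setE => /(_ m'C).
apply/negP; rewrite -ltNge -/z.
have -> : G (m - t *: z) - y = (G (m - t *: z) - G m - (m - t *: z - m)) + (1 - t) *: z.
  by rewrite /z; apply/rowP => k; rewrite !mxE; ring.
apply: le_lt_trans (ler_normD _ _) _.
have := Glip _ _ (sr _ m'C) mr.
have -> : `|m - t *: z - m| = t * `|z|.
  by rewrite addrAC subrr sub0r normrN normrZ gtr0_norm.
rewrite normrZ (@ger0_norm _ (1 - t)) ?subr_ge0 //.
have : 0 < t * `|z| by rewrite mulr_gt0.
by lra.
Qed.

(** After composition with the inverse of the Jacobian at [x0], [f] is near [x0]
    the identity plus a contraction. *)
Lemma C1_local_homeo n (f : 'rV[R]_n -> 'rV[R]_n) x0 :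
  C1_map f -> \det (jacobian f x0) != 0 ->
  (exists2 r : R, 0 < r & forall u v, ball x0 r u -> ball x0 r v -> f u = f v -> u = v) /\
  (forall A, nbhs x0 A -> nbhs (f x0) (f @` A)).
Proof.
move=> fC1 J0.
have Ju : jacobian f x0 \in unitmx by rewrite unitmxE unitfE.
set B := invmx (jacobian f x0).
have nB0 : 0 <= n%:R * `|B| by rewrite mulr_ge0.
have e0 : 0 < 2^-1 / (n%:R * `|B| + 1) :> R by rewrite divr_gt0 //; lra.
have [r r0 rP] := C1_strictly_differentiable n n f x0 _ fC1 e0.
have fc : continuous f.
  by move=> x; apply: differentiable_continuous; exact: fC1.1.
pose G x := f x *m B.
have mulBc : continuous (fun y : 'rV[R]_n => y *m B).
  move=> y U /nbhs_ballP[e /= e_gt0 eU]; apply/nbhs_ballP.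
  exists (e / (n%:R * `|B| + 1)) => /=; first by rewrite divr_gt0 //; lra.
  move=> x xy; apply: eU; move: xy; rewrite -!ball_normE /= ltr_pdivlMr; last by lra.
  move=> xy; rewrite -mulmxBl; apply: le_lt_trans (norm_mulmx _ _ _ _) _.
  by apply: le_lt_trans xy; rewrite mulrC ler_wpM2l //; lra.
have Glip u v : ball x0 r u -> ball x0 r v ->
    `|G u - G v - (u - v)| <= 2^-1 * `|u - v|.
  move=> ur vr; have := rP _ _ ur vr.
  have -> : G u - G v - (u - v) = (f u - f v - (u - v) *m jacobian f x0) *m B.
    by rewrite 2!mulmxBl -mulmxA mulmxV // mulmx1.
  set D := f u - f v - _ => hD.
  apply: le_trans (norm_mulmx _ _ _ _) _.
  apply: (@le_trans _ _ ((n%:R * `|B| + 1) * `|D|)); first by rewrite ler_wpM2r //; lra.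
  by rewrite mulrC -ler_pdivlMr; [rewrite mulrAC|lra].
split.
  exists r => // u v ur vr fuv.
  have := Glip _ _ ur vr; rewrite /G fuv subrr sub0r normrN => h.
  have : `|u - v| <= 0 by lra.
  by rewrite normr_le0 subr_eq0 => /eqP.
move=> A Ax0.
have cG : continuous G by move=> x; exact: (continuous_comp (fc x) (mulBc (f x))).
have nGA := near_identity_open n G x0 r A cG r0 Glip Ax0.
have : nbhs (f x0) ((fun y : 'rV[R]_n => y *m B) @^-1` (G @` A)) by exact: mulBc.
apply: filterS => y [x Ax Gxy]; exists x => //.
have := congr1 (mulmx^~ (jacobian f x0)) Gxy.
by rewrite /G /= -!mulmxA mulVmx // !mulmx1.
Qed.

End inverse_function.

(** * Connectedness *)

Section connectedness.

Lemma locally_constant_connected (T : topologicalType) (U : Type) (h : T -> U)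
    (A : set T) : connected A ->
  (forall t, A t -> \forall t' \near t, h t' = h t) ->
  forall s t, A s -> A t -> h s = h t.
Proof.
move=> cA hA s t As At.
suff AB : A `&` [set u | h u = h s] = A.
  by move: At; rewrite -{1}AB => -[].
apply: cA.
- by exists s.
- exists (interior [set u | h u = h s]); first exact: open_interior.
  apply/seteqP; split=> u [Au hu]; split => //; last exact: interior_subset hu.
  by have := hA _ Au; rewrite /= in hu; rewrite hu.
- exists (~` interior [set u | h u <> h s]).
    by rewrite closedC; exact: open_interior.
  apply/seteqP; split=> u [Au hu]; split => //.
    by move=> /interior_subset.
  apply: contrapT => hu'; apply: hu; have := hA _ Au.
  by apply: filterS => v /= ->.
Qed.

Lemma convex_connected (R : realType) (V : normedModType R) (A : set V) :
  (forall x y t, A x -> A y -> 0 <= t -> t <= 1 -> A (x + t *: (y - x))) ->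
  connected A.
Proof.
move=> Aconv; have [->|/set0P[p Ap]] := eqVneq A set0; first exact: connected0.
pose seg q := (fun t : R => p + t *: (q - p)) @` `[0, 1].
have -> : A = \bigcup_(q in A) seg q.
  apply/seteqP; split=> [q Aq|_ [q Aq [t + <-]]].
    exists q => //; exists 1; first by rewrite /= in_itv /= ler01 lexx.
    by rewrite scale1r addrC subrK.
  by rewrite /= in_itv /= => /andP[t0 t1]; exact: Aconv.
apply: bigcup_connected.
  exists p => q Aq; exists 0; first by rewrite /= in_itv /= ler01 lexx.
  by rewrite scale0r addr0.
move=> q Aq; apply: connected_continuous_connected; first exact: segment_connected.
apply: continuous_subspaceT => t; apply: differentiable_continuous; exact: ex_diff.
Qed.

Lemma half_space_connected (R : realType) n (s : R) i (c : R) :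
  connected [set x : 'rV[R]_n | c < s * x ord0 i].
Proof.
apply: convex_connected => x y t /= cx cy t0 t1; rewrite !mxE.
have [->|tn0] := eqVneq t 0; first by rewrite mul0r addr0.
have tp : 0 < t by rewrite lt_def tn0.
have : t * c < t * (s * y ord0 i) by rewrite ltr_pM2l.
have : (1 - t) * c <= (1 - t) * (s * x ord0 i) by rewrite ler_wpM2l ?subr_ge0 // ltW.
by move=> h1 h2; nra.
Qed.

(** For the sup norm this exterior is the union of four half-planes; those in
    each of the pairs joined below meet in a quadrant. *)
Lemma cube_exterior_connected (R : realType) (c : R) : 0 <= c ->
  connected [set x : 'rV[R]_2 | c < `|x|].
Proof.
move=> c0.
pose H (s : R) (i : 'I_2) := [set x : 'rV[R]_2 | c < s * x ord0 i].
pose i0 : 'I_2 := ord0; pose i1 : 'I_2 := ord_max.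
have -> : [set x : 'rV[R]_2 | c < `|x|] =
    (H 1 i0 `|` H 1 i1) `|` (H (-1) i0 `|` H (-1) i1).
  apply/seteqP; split => x /=; last first.
    have geP i : (1 * x ord0 i <= `|x|) /\ (-1 * x ord0 i <= `|x|).
      rewrite mul1r mulN1r; have := row_norm_ge _ _ x ord0 i; rewrite ler_norml => /andP[? ?].
      by split; rewrite // lerNl.
    have P i := (geP i).1; have N i := (geP i).2.
    by move=> [[|]|[|]] /lt_le_trans; apply.
  rewrite [in X in X -> _]/Num.norm /= mx_normrE => /bigmax_gtP[|[[j i] _ /=]].
    by rewrite ltNge c0.
  rewrite (ord1 j) lter_normr => {j}; rewrite /H /= !mul1r !mulN1r.
  have : i = i0 \/ i = i1.
    by case: i => [[|[|//]]] ?; [left|right]; exact: val_inj.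
  by move=> [] -> /orP[]; tauto.
pose pt (a b : R) : 'rV[R]_2 := \row_i (if i == i0 then a else b).
have c1 : c < c + 1 by rewrite ltrDl.
apply: connectedU.
- exists (pt (c + 1) (- (c + 1))); split; [left|right];
    by rewrite /H /= mxE /= ?mul1r ?mulN1r ?opprK.
- apply: connectedU; last exact: half_space_connected; last exact: half_space_connected.
  by exists (pt (c + 1) (c + 1)); split; rewrite /H /= mxE /= ?mul1r.
- apply: connectedU; last exact: half_space_connected; last exact: half_space_connected.
  by exists (pt (- (c + 1)) (- (c + 1))); split; rewrite /H /= mxE /= ?mulN1r ?opprK.
Qed.

End connectedness.

(** * Proper maps of R^n *)

Section proper_maps.
Context {R : realType} {n : nat}.
Local Notation E := 'rV[R]_n.
Implicit Types (f : E -> E).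

(** With [bounded_proper_at], this reduces properness at [y] to a bound on the
    fibres over the points near [y]. *)
Lemma proper_at_bounded f y : proper_at f y ->
  exists M, \forall y' \near y, forall x, f x = y' -> `|x| <= M.
Proof.
move=> [U [yU /compact_bounded [M [Mr Mb]]]].
exists (M + 1); apply: filterS yU => y' Uy' x fxy'.
by apply: Mb; [rewrite ltrDl|rewrite /= fxy'; exact: subset_closure].
Qed.

Lemma bounded_proper_at f y M : continuous f ->
  (\forall y' \near y, forall x, f x = y' -> `|x| <= M) -> proper_at f y.
Proof.
move=> fc /nbhs_ballP[e /= e0 eM].
exists [set z | `|z - y| <= e / 2]; split.
  apply/nbhs_ballP; exists (e / 2) => /=; first by rewrite divr_gt0.
  by move=> z; rewrite -ball_normE /= distrC => /ltW.
have idc : continuous (@id E) by move=> x; exact: cvg_id.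
rewrite -(closure_id _).1; last exact: closed_dist_le idc.
apply: bounded_closed_compact; last exact: closed_dist_le.
apply: (bounded_setP _ _ _ M) => x /= fx; apply: (eM (f x)) => //.
rewrite -ball_normE /= distrC; apply: le_lt_trans fx _.
by rewrite ltr_pdivrMr // ltr_pMr // ltr1n.
Qed.

Lemma proper_on_compact f (K : set E) : compact K ->
  (forall y, K y -> proper_at f y) ->
  exists M, forall x, K (f x) -> `|x| <= M.
Proof.
move=> /compact_near_coveringP cK Kp.
pose P (M : R) (y : E) := forall x, f x = y -> `|x| <= M.
have [|N [_ NP]] := cK R (pinfty_nbhs R) P _.
  move=> y /Kp /proper_at_bounded [M My].
  exists ([set y' | P M y'], [set N | M < N]).
    by split => //=; exists M; split; [exact: num_real|].
  by move=> [y' N] /= [yM MN] x /yM xM; exact: le_trans xM (ltW MN).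
exists (N + 1) => x Kfx.
by apply: (NP (N + 1) _ (f x)) => //; rewrite ltrDl.
Qed.

Lemma closure_range_proper f y : continuous f -> proper_at f y ->
  closure (range f) y -> range f y.
Proof.
move=> fc [U [yU Uc]] yf.
have : closure (f @` (f @^-1` closure U)) y.
  move=> V yV; have [_ [[x _ <-] [Ufx Vfx]]] := yf _ (filterI yU yV).
  by exists (f x); split => //; exists x => //; exact: subset_closure.
rewrite -(closure_id _).1; first by move=> [x _ <-]; exists x.
apply: compact_closed; first exact: norm_hausdorff.
by apply: continuous_compact => //; exact: continuous_subspaceT.
Qed.

(** The range is open, and by [closure_range_proper] it is closed in the set of
    points where [f] is proper; so membership in the range is locally constant
    along a path in that set. *)
Lemma range_along_connected (T : topologicalType) f (g : T -> E) (A : set T) :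
  continuous f -> neighborhood_open f ->
  continuous g -> connected A -> (forall t, A t -> proper_at f (g t)) ->
  forall s t, A s -> A t -> range f (g s) -> range f (g t).
Proof.
move=> fc fo gc Ac Ap s t As At rs.
suff <- : range f (g s) = range f (g t) by [].
apply: (locally_constant_connected T Prop (fun t => range f (g t)) A Ac) => // u Au.
have [ru|ru] := pselect (range f (g u)).
  have nu : nbhs (g u) (range f) by have [x _ <-] := ru; apply: fo; exact: filterT.
  have : \forall v \near u, range f (g v) by exact: gc.
  by apply: filterS => v rv; apply/propext.
have nu : nbhs (g u) (~` closure (range f)).
  apply: open_nbhs_nbhs; split; first by rewrite openC; exact: closed_closure.
  by move=> /(closure_range_proper f (g u) fc (Ap _ Au)).
have : \forall v \near u, (~` closure (range f)) (g v) by exact: gc.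
apply: filterS => v rv; apply/propext; split => // rv'.
by case: rv; exact: subset_closure.
Qed.

Lemma line_continuous (a b : E) : continuous (fun t : R => a + t *: b).
Proof. by move=> t; apply: differentiable_continuous; exact: ex_diff. Qed.

Lemma real_connected : connected [set: R].
Proof. by apply/connected_intervalP => x y _ _ z _. Qed.

Lemma proper_open_surjective f :
  continuous f -> neighborhood_open f ->
  (forall y, proper_at f y) -> forall y, range f y.
Proof.
move=> fc fo fp y.
have -> : y = f 0 + (1 : R) *: (y - f 0) by rewrite scale1r addrC subrK.
apply: (range_along_connected R f (fun t => f 0 + t *: (y - f 0)) setT fc fo
  (line_continuous _ _) real_connected _ 0 1) => //.
by exists 0 => //; rewrite scale0r addr0.
Qed.

Lemma uniform_local_injectivity f (C : set E) : compact C ->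
  locally_injective f ->
  exists2 e : R, 0 < e & forall x u v, C x -> ball x e u -> ball x e v ->
    f u = f v -> u = v.
Proof.
move=> /compact_near_coveringP cC finj.
pose P (e : R) (x : E) := forall u v, ball x e u -> ball x e v -> f u = f v -> u = v.
have [|e /= e0 eP] := cC R (0^'+) P _.
  move=> x _; have [r r0 rP] := finj x.
  exists (ball x (r / 2), [set e | e < r / 2]).
    split => /=; first by apply: nbhsx_ballx; rewrite divr_gt0.
    exists (r / 2) => /=; first by rewrite divr_gt0.
    by move=> e /= + e0; rewrite sub0r normrN gtr0_norm.
  move=> [x' e] /= [xx' er] u v x'u x'v; apply: rP.
  - rewrite (splitr r); apply: ball_triangle xx' _; exact: le_ball (ltW er) _ x'u.
  - rewrite (splitr r); apply: ball_triangle xx' _; exact: le_ball (ltW er) _ x'v.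
exists (e / 2) => [|x u v Cx xu xv]; first by rewrite divr_gt0.
apply: (eP (e / 2) _ _ x) => //=; last by rewrite divr_gt0.
by rewrite sub0r normrN gtr0_norm ?divr_gt0 // ltr_pdivrMr // ltr_pMr // ltr1n.
Qed.

Lemma uniform_openness f (C : set E) (e : R) : compact C -> continuous f ->
  neighborhood_open f -> 0 < e ->
  exists2 d : R, 0 < d & forall x y, C x -> ball (f x) d y ->
    exists2 x', ball x e x' & f x' = y.
Proof.
move=> /compact_near_coveringP cC fc fo e0.
pose P (d : R) (x : E) := forall y, ball (f x) d y -> exists2 x', ball x e x' & f x' = y.
have [|d /= d0 dP] := cC R (0^'+) P _.
  move=> x _; have e20 : 0 < e / 2 by rewrite divr_gt0.
  have /nbhs_ballP[r /= r0 rf] := fo x _ (nbhsx_ballx x _ e20).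
  have r20 : 0 < r / 2 by rewrite divr_gt0.
  exists (ball x (e / 2) `&` f @^-1` ball (f x) (r / 2), [set d | d < r / 2]).
    split => /=.
      by apply: filterI; [exact: nbhsx_ballx|exact: fc (nbhsx_ballx _ _ r20)].
    by exists (r / 2) => //= d /= + d0; rewrite sub0r normrN gtr0_norm.
  move=> [x' d] /= [[xx' fxx'] dr] y fy.
  have [|z xz fz] := rf y.
    rewrite (splitr r); apply: ball_triangle fxx' _; exact: le_ball (ltW dr) _ fy.
  exists z => //; rewrite (splitr e); apply: ball_triangle xz; exact: ball_sym.
exists (d / 2) => [|x y Cx fxy]; first by rewrite divr_gt0.
apply: (dP (d / 2) _ _ x) => //=; last by rewrite divr_gt0.
by rewrite sub0r normrN gtr0_norm ?divr_gt0 // ltr_pdivrMr // ltr_pMr // ltr1n.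
Qed.

(** A lift through [f], over the open ball of radius [M] around [y0], of the
    homothety of centre [y0] and ratio [mu]; it fixes the fibre over [y0]. *)
Definition radial_lift f (y0 : E) (M mu : R) : Prop :=
  exists phi : E -> E, forall x, `|f x - y0| < M ->
    [/\ {for x, continuous phi}, f (phi x) = y0 + mu *: (f x - y0) &
        f x = y0 -> phi x = x].

(** A lift for [mu] moves to [mu'] by replacing phi x with the unique preimage,
    within distance [e] of phi x, of the homothetic image of f x with ratio
    [mu']. This preimage exists since the target moves by less than [d]. It
    depends continuously on x because [f] is open: near x there is a preimage
    close to the chosen one, and by uniqueness it is the chosen one. *)
Lemma radial_lift_step f y0 M e d mu mu' :
  continuous f -> neighborhood_open f ->
  (forall x u v, `|f x - y0| <= M -> ball x e u -> ball x e v ->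
    f u = f v -> u = v) ->
  (forall x y, `|f x - y0| <= M -> ball (f x) d y ->
    exists2 x', ball x e x' & f x' = y) ->
  0 < e -> 0 <= mu' -> mu' <= mu -> mu <= 1 -> (mu - mu') * M < d ->
  radial_lift f y0 M mu -> radial_lift f y0 M mu'.
Proof.
move=> fc fo einj dopen e0 mu'0 mu'mu mu1 muM [phi phiP].
have phiC x : `|f x - y0| < M -> `|f (phi x) - y0| <= M.
  move=> xM; have [_ -> _] := phiP x xM.
  rewrite addrC addKr normrZ ger0_norm; last exact: le_trans mu'mu.
  by apply: le_trans (ltW xM); rewrite ler_piMl.
have /choice[psi psiP] : forall x, exists x', `|f x - y0| < M ->
    ball (phi x) e x' /\ f x' = y0 + mu' *: (f x - y0).
  move=> x; have [xM|nxM] := pselect (`|f x - y0| < M); last by exists x.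
  have [|x' xx' fx'] := dopen _ (y0 + mu' *: (f x - y0)) (phiC _ xM).
    have [_ -> _] := phiP x xM.
    rewrite -ball_normE /= opprD addrACA subrr add0r -scalerBl normrZ ger0_norm ?subr_ge0 //.
    by apply: le_lt_trans muM; rewrite ler_wpM2l ?subr_ge0 // ltW.
  by exists x'.
exists psi => x xM; have [phix fphix phifix] := phiP x xM.
have [psie fpsi] := psiP x xM.
split => //; last first.
  move=> fx; have := phifix fx => phixE.
  apply: (einj x) => //; first exact: ltW.
  - by move: psie; rewrite phixE.
  - exact: ballxx.
  - by rewrite fpsi fx subrr scaler0 addr0.
move=> V Vpsi.
(* Points within h of phi x and of psi x are at distance less than e. *)
pose h := (e - `|phi x - psi x|) / 2.
have h0 : 0 < h.
  by rewrite divr_gt0 // subr_gt0; move: psie; rewrite -ball_normE.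
have nV : nbhs (psi x) (V `&` ball (psi x) h).
  by apply: filterI => //; exact: nbhsx_ballx.
have gc : {for x, continuous (fun z => y0 + mu' *: (f z - y0))}.
  apply: (@continuous_comp _ _ _ f (fun z : E => y0 + mu' *: (z - y0))).
    exact: fc.
  by apply: differentiable_continuous; exact: ex_diff.
have near1 : \forall z \near x, (f @` (V `&` ball (psi x) h)) (y0 + mu' *: (f z - y0)).
  by apply: gc; rewrite /= -fpsi; exact: fo.
have near2 : \forall z \near x, ball (phi x) h (phi z).
  by apply: phix; exact: nbhsx_ballx.
have near3 : \forall z \near x, `|f z - y0| < M.
  have /= := continuous_dist R _ _ f y0 x (fc x).
  by move/cvgr_lt; apply.
change (\forall z \near x, V (psi z)); near=> z.
have zM : `|f z - y0| < M by near: z; exact: near3.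
have [w [Vw wh] fw] : (f @` (V `&` ball (psi x) h)) (y0 + mu' *: (f z - y0)).
  by near: z; exact: near1.
have phizh : ball (phi x) h (phi z) by near: z; exact: near2.
have [psize fpsiz] := psiP z zM.
suff <- : w = psi z by [].
apply: (einj (phi z)) => //; [exact: phiC| |by rewrite fw fpsiz].
move: wh phizh; rewrite -!ball_normE /= => wh phizh.
have -> : phi z - w = (phi x - psi x) + (psi x - w) - (phi x - phi z).
  by apply/rowP => k; rewrite !mxE; ring.
apply: le_lt_trans (ler_normB _ _) _.
have := ler_normD (phi x - psi x) (psi x - w).
by rewrite /h in wh phizh; lra.
Unshelve. all: by end_near. Qed.

Lemma radial_lift1 f y0 M : radial_lift f y0 M 1.
Proof.
by exists id => x _; split; [exact: cvg_id|rewrite scale1r addrC subrK|].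
Qed.

(** Properness makes the preimage of the ball compact, so the radii [e] and [d]
    of the step can be chosen uniformly and finitely many steps lead from ratio 1
    to ratio 0. *)
Lemma radial_lift0 f y0 M :
  continuous f -> neighborhood_open f ->
  locally_injective f ->
  (forall y, proper_at f y) -> 0 < M -> radial_lift f y0 M 0.
Proof.
move=> fc fo finj fp M0.
pose C := [set x | `|f x - y0| <= M].
have [D CD] := proper_on_compact f _ (compact_dist_le R n y0 M) (fun y _ => fp y).
have Cc : compact C.
  by apply: bounded_closed_compact; [exact: bounded_setP CD|exact: closed_dist_le].
have [e e0 eP] := uniform_local_injectivity f C Cc finj.
have [d d0 dP] := uniform_openness f C e Cc fc fo e0.
pose N := Num.truncn (M / d).
have NM : N.+1%:R^-1 * M < d.
  rewrite mulrC ltr_pdivrMr // mulrC -ltr_pdivrMr //; exact: truncnS_gt.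
have lift k : (k <= N.+1)%N -> radial_lift f y0 M (1 - k%:R / N.+1%:R).
  elim: k => [_|k IH kN]; first by rewrite mul0r subr0; exact: radial_lift1.
  have k1 : k.+1%:R / N.+1%:R <= 1 :> R.
    by rewrite ler_pdivrMr // mul1r ler_nat.
  have kk1 : k.+1%:R / N.+1%:R = k%:R / N.+1%:R + N.+1%:R^-1 :> R.
    by rewrite -natr1 mulrDl mul1r.
  have N0 : 0 < N.+1%:R^-1 :> R by rewrite invr_gt0.
  have k0 : 0 <= k%:R / N.+1%:R :> R by rewrite divr_ge0.
  apply: (radial_lift_step f y0 M e d (1 - k%:R / N.+1%:R)) => //.
  - by rewrite subr_ge0.
  - by rewrite lerD2l lerN2 kk1 lerDl ltW.
  - by rewrite kk1; have -> : forall a b : R, 1 - a - (1 - (a + b)) = b by move=> a b; ring.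
  - by apply: IH; exact: ltnW.
by have := lift N.+1 (leqnn _); rewrite divff // subrr.
Qed.

(** Lifting the homothety of ratio 0 sends the segment from [a] to [b] into the
    fibre over y0 = f a = f b, continuously and fixing [a] and [b]. Since [f] is
    locally injective the fibre is discrete, so the image is a single point. *)
Lemma proper_local_homeo_injective f :
  continuous f -> neighborhood_open f ->
  locally_injective f ->
  (forall y, proper_at f y) -> injective f.
Proof.
move=> fc fo finj fp a b fab; set y0 := f a.
pose g (t : R) := a + t *: (b - a).
have gc : continuous g by exact: line_continuous.
pose I : set R := `[0, 1]%classic.
have Ic : connected I by exact: segment_connected.
have I0 : I 0 by rewrite /I /= in_itv /= ler01 lexx.
have I1 : I 1 by rewrite /I /= in_itv /= ler01 lexx.
have dc : continuous (fun t => `|f (g t) - y0|).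
  move=> t; apply: (continuous_dist R _ _ (f \o g) y0 t).
  by apply: continuous_comp; [exact: gc|exact: fc].
have [|c cI cmax] := @EVT_max R (fun t => `|f (g t) - y0|) 0 1 ler01.
  exact: continuous_subspaceT.
pose M := `|f (g c) - y0| + 1.
have M0 : 0 < M by rewrite ltr_wpDl.
have gM t : I t -> `|f (g t) - y0| < M.
  by move=> It; apply: le_lt_trans (cmax t It) _; rewrite ltrDl.
have [phi phiP] := radial_lift0 f y0 M fc fo finj fp M0.
have -> : a = phi (g 0).
  by have [_ _ ->] := phiP _ (gM _ I0); rewrite /g scale0r addr0.
have -> : b = phi (g 1).
  by have [_ _ ->] := phiP _ (gM _ I1); rewrite /g scale1r addrC subrK.
apply: (locally_constant_connected R E (phi \o g) I Ic) => // t It.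
have [r r0 rP] := finj (phi (g t)).
have near1 : \forall s \near t, ball (phi (g t)) r (phi (g s)).
  have [phic _ _] := phiP _ (gM _ It).
  have : {for t, continuous (phi \o g)} by apply: continuous_comp; [exact: gc|].
  by apply; exact: nbhsx_ballx.
have near2 : \forall s \near t, `|f (g s) - y0| < M.
  have := dc t; move/cvgr_lt; apply; exact: gM.
apply: filterS2 near1 near2 => s /= sr sM.
apply: rP => //; first exact: ballxx.
have [_ -> _] := phiP _ sM; have [_ -> _] := phiP _ (gM _ It).
by rewrite !scale0r.
Qed.

End proper_maps.

(** * Properness in the plane *)

Section plane.
Context {R : realType}.
Implicit Type f : 'rV[R]_2 -> 'rV[R]_2.

(** The preimage of the sphere of radius [M] is bounded, say by D. On the
    connected exterior of the ball of radius D the function |f| avoids [M], and it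
    takes values above [M] because [f] is unbounded. So |f| > [M] there, and the
    preimage of the open ball of radius [M] is bounded. *)
Lemma proper_of_bounded_nonproper f M :
  continuous f -> (forall y, nonproper_set f y -> `|y| < M) ->
  (forall m, exists x, m < `|f x|) -> forall y, proper_at f y.
Proof.
move=> fc SM funb.
pose K := [set y : 'rV[R]_2 | `|y| = M].
have Kc : compact K.
  apply: bounded_closed_compact.
    by apply: (bounded_setP _ _ _ M) => y /= ->.
  have -> : K = Num.norm @^-1` [set t : R | t = M] by [].
  by apply: closed_comp => [y _|]; [exact: norm_continuous|exact: closed_eq].
have [D KD] : exists D, forall x, K (f x) -> `|x| <= D.
  apply: proper_on_compact Kc _ => y yM; apply: contrapT => /SM.
  by rewrite yM ltxx.
pose D' := Num.max D 0.
have Ac := cube_exterior_connected R D' ltac:(by rewrite le_max lexx orbT).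
have Bc : connected ((fun x => `|f x|) @` [set x | D' < `|x|]).
  apply: connected_continuous_connected => //; apply: continuous_subspaceT => x.
  by apply: (@continuous_comp _ _ _ f Num.norm); [exact: fc|exact: norm_continuous].
move/connected_intervalP in Bc.
have [x0 D'x0 fx0] : exists2 x, D' < `|x| & M < `|f x|.
  have ballc := compact_dist_le R 2 0 D'.
  have /compact_bounded[m [_ mb]] : compact (f @` [set x : 'rV[R]_2 | `|x - 0| <= D']).
    by apply: continuous_compact => //; exact: continuous_subspaceT.
  have [x] := funb (Num.max M (m + 1)); rewrite gt_max => /andP[Mx mx].
  exists x => //; rewrite ltNge; apply/negP => xD.
  have : `|f x| <= m + 1.
    by apply: mb; [rewrite ltrDl|exists x => //=; rewrite subr0].
  by rewrite leNgt mx.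
have far x : `|f x| < M -> `|x| <= D'.
  move=> fxM; rewrite leNgt; apply/negP => D'x.
  have [|||x1 D'x1 fx1] := Bc `|f x| `|f x0| _ _ M.
  - by exists x.
  - by exists x0.
  - by rewrite !ltW.
  have := KD x1 fx1; apply/negP; rewrite -ltNge; apply: le_lt_trans D'x1.
  by rewrite le_max lexx.
move=> y; have [yM|My] := ltP `|y| M; last first.
  by apply: contrapT => /SM; rewrite ltNge My.
apply: (bounded_proper_at f y D' fc).
have : \forall y' \near y, `|y'| < M.
  have nc : Num.norm x @[x --> y] --> `|y| by exact: norm_continuous.
  by move/cvgr_lt : nc; apply.
by apply: filterS => y' y'M x fxy'; apply: far; rewrite fxy'.
Qed.

(** Infinitely many horizontal lines meet the open range of [f], and only finitely
    many meet the non-properness set; a line that meets the range but not that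
    set lies entirely in the range. *)
Lemma unbounded_of_finite_nonproper f :
  continuous f -> neighborhood_open f ->
  finite_set (nonproper_set f) -> forall m, exists x, m < `|f x|.
Proof.
move=> fc fo Sfin m.
have [e /= e0 ef] : exists2 e : R, 0 < e & ball (f 0) e `<=` range f.
  by apply/nbhs_ballP; apply: fo; exact: filterT.
pose pt (a b : R) : 'rV[R]_2 := \row_i (if i == ord0 then a else b).
pose c := f 0 ord0 ord_max.
have [b be bS] : exists2 b, `|b - c| < e &
    ~ [set y ord0 ord_max | y in nonproper_set f] b.
  apply: contrapT => nb.
  have Tfin : finite_set [set y ord0 ord_max | y in nonproper_set f].
    exact: finite_image.
  have : finite_set [set b | `|b - c| < e].
    apply: sub_finite_set Tfin => b be; apply: contrapT => bS; apply: nb.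
    by exists b.
  have e2 : 0 < e / 2 by rewrite divr_gt0.
  move=> cefin; have : finite_set (`[c, c + e / 2]%classic : set R).
    apply: sub_finite_set cefin => b /=; rewrite in_itv /= => /andP[cb bce].
    by rewrite ger0_norm ?subr_ge0 //; lra.
  move/finite_set_countable/countable_lebesgue_measure0.
  rewrite lebesgue_measure_itv /= lte_fin ltrDl e2 -EFinB addrC addKr => /eqP.
  by rewrite eqe gt_eqF.
have cE : f 0 = pt (f 0 ord0 ord0) c.
  apply/rowP => -[[|[|//]]] i; rewrite mxE /=; congr (f 0 ord0 _); exact: val_inj.
have line t : pt (f 0 ord0 ord0) b + t *: pt 1 0 = pt (f 0 ord0 ord0 + t) b.
  by apply/rowP => i; rewrite !mxE; case: ifP => _; rewrite ?mulr1 ?mulr0 ?addr0.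
pose t0 := `|m| + `|f 0 ord0 ord0| + 1.
have : range f (pt (f 0 ord0 ord0) b + t0 *: pt 1 0).
  apply: (range_along_connected R f
    (fun t => pt (f 0 ord0 ord0) b + t *: pt 1 0) setT fc fo
    (line_continuous _ _) real_connected _ 0 t0) => //.
    move=> t _; rewrite line; apply: contrapT => Sp; apply: bS.
    by exists (pt (f 0 ord0 ord0 + t) b) => //; rewrite mxE.
  rewrite scale0r addr0; apply: ef; rewrite -ball_normE /= {1}cE.
  apply: le_lt_trans (_ : _ <= `|b - c|) be.
  apply: row_norm_le => // i j; rewrite !mxE; case: ifP => _.
    by rewrite subrr normr0.
  by rewrite distrC.
rewrite line => -[x _ fx]; exists x; rewrite fx.
apply: lt_le_trans (row_norm_ge _ _ _ ord0 ord0).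
rewrite mxE /=; apply: lt_le_trans (ler_norm _).
have := ler_norm m; have := ler_norm (- f 0 ord0 ord0).
by rewrite normrN /t0; lra.
Qed.

End plane.

(** * The theorem *)

Theorem proposition2p13 (R : realType) (f : 'rV[R]_2 -> 'rV[R]_2)
    (f_C1 : C1_map f)
    (f_semialg : semialgebraic_map f)
    (f_jac : forall x : 'rV[R]_2, \det (jacobian f x) != 0)
    (codim_Sf : (2%:R%:E <= semialg_codim (nonproper_set f))%E) :
  bijective f.
Proof.
have fc : continuous f.
  by move=> x; apply: differentiable_continuous; exact: f_C1.1.
have finj : locally_injective f by move=> x; have [] := C1_local_homeo 2 f x f_C1 (f_jac x).
have fo : neighborhood_open f by move=> x; have [] := C1_local_homeo 2 f x f_C1 (f_jac x).
have Sfin := finite_of_semialg_codim _ codim_Sf.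
have [M SM] : exists M, forall y, nonproper_set f y -> `|y| < M.
  have /compact_bounded[m [_ mS]] := finite_compact Sfin.
  exists (m + 2) => y Sy.
  by apply: (@le_lt_trans _ _ (m + 1)); [apply: mS => //; rewrite ltrDl|lra].
have fp := proper_of_bounded_nonproper f M fc SM
  (unbounded_of_finite_nonproper f fc fo Sfin).
have /choice[g fg] : forall y, exists x, f x = y.
  by move=> y; have [x _ fx] := proper_open_surjective f fc fo fp y; exists x.
exists g => // x.
by apply: (proper_local_homeo_injective f fc fo finj fp).
Qed.
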